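(* Let $\ell\ge 3$ and $n\ge 1$ be integers, write $n=(\ell-1)q+r$ with integers $q\ge 0$ and $0\le r<\ell-1$, and let $\varphi:[0,n-1]\to\mathbb R$ be nondecreasing and convex. Then $$\operatorname{ex}_\varphi^+(n,\overrightarrow C_\ell)=\sum_{i=1}^{q}(\ell-1)\,\varphi\big((\ell-1)(q-i+1)-1+r\big)+\begin{cases} r\,\varphi(r-1), & r>0,\\ 0,& r=0.\end{cases}$$
   Context: Digraphs are finite and loopless; digons (pairs of opposite arcs on the same two vertices) are allowed. $\overrightarrow C_\ell$ is the directed cycle of length $\ell$. A digraph is $F$-free if it contains no (not necessarily induced) subdigraph isomorphic to $F$. $d_D^+(v)$ is the out-degree. For a loopless digraph $F$ and nondecreasing convex $\varphi:[0,n-1]\to\mathbb R$, $$\operatorname{ex}_\varphi^+(n,F)=\max\Big\{\sum_{v\in V(D)}\varphi(d_D^+(v)) : |V(D)|=n,\ D\text{ is }F\text{-free}\Big\}.$$ *)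

(* Defs.v *)
From HB Require Import structures.
From mathcomp Require Import all_boot all_order all_algebra.
From mathcomp Require Import all_classical all_reals.

Set Implicit Arguments.
Unset Strict Implicit.
Unset Printing Implicit Defensive.

Import Order.TTheory GRing.Theory Num.Theory.

Local Open Scope classical_set_scope.
Local Open Scope ring_scope.

(* [is_arc x y] means x -> y; arcs both ways between x and y (a digon) may
   occur. *)
Record digraph := Digraph {
  vertex :> finType;
  is_arc : rel vertex;
  arc_irrefl : irreflexive is_arc }.

Definition outdeg (D : digraph) (v : D) : nat := #|[pred w : D | is_arc v w]|.

(* The subdigraph need not be induced: arcs are preserved, not reflected. *)
Definition contains_copy (F D : digraph) : Prop :=
  exists f : F -> D,
    injective f /\ forall x y : F, is_arc x y -> is_arc (f x) (f y).

Definition free_of (F D : digraph) : Prop := ~ contains_copy F D.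

Lemma dicycle_irrefl (l : nat) (hl : (1 < l)%N) :
  irreflexive (fun i j : 'I_l => j == ordS i).
Proof.
move=> i; apply/negbTE/eqP => /(congr1 val) /= e.
have := ltn_ord i; rewrite leq_eqVlt => /orP[/eqP il|il].
  by move: e hl; rewrite il modnn => i0; rewrite -il i0.
by move: e; rewrite modn_small // => /eqP; rewrite ltn_eqF.
Qed.

Definition dicycle (l : nat) (hl : (1 < l)%N) : digraph :=
  Digraph (dicycle_irrefl hl).

Definition ex_values (R : realType) (phi : R -> R) (n : nat) (F : digraph) :
    set R :=
  [set x | exists D : digraph,
     [/\ #|D| = n, free_of F D & x = \sum_(v : D) phi (outdeg v)%:R]].

Definition is_max (R : realType) (A : set R) (m : R) : Prop :=
  A m /\ ubound A m.

(* The maximum of [ex_values]; the default value 0 of [xget] plays no role as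
   soon as F has an arc, see [ex_plusP]. *)
Definition ex_plus (R : realType) (phi : R -> R) (n : nat) (F : digraph) : R :=
  xget 0 (is_max (ex_values phi n F)).

Lemma ex_plusP (R : realType) (phi : R -> R) (n : nat) (F : digraph) (x y : F) :
  is_arc x y -> is_max (ex_values phi n F) (ex_plus phi n F).
Proof.
move=> xy; apply: xgetPex.
pose w (f : {ffun 'I_n -> 'I_n.+1}) : R := \sum_i phi (f i)%:R.
have Vw z : ex_values phi n F z -> exists f, z = w f.
  case=> D [cD _ ->].
  have dn (v : D) : (outdeg v < n.+1)%N by rewrite ltnS -cD max_card.
  exists [ffun i => Ordinal (dn (enum_val (cast_ord (esym cD) i)))].
  rewrite /w (reindex (fun i : 'I_n => enum_val (cast_ord (esym cD) i))) /=.
    by apply: eq_bigr => i _; rewrite ffunE.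
  exists (fun v => cast_ord cD (enum_rank v)) => v _.
    by rewrite enum_valK cast_ordKV.
  by rewrite cast_ordK enum_rankK.
have irr0 : irreflexive (fun _ _ : 'I_n => false) by [].
have V0 : ex_values phi n F (\sum_(v : Digraph irr0) phi (outdeg v)%:R).
  exists (Digraph irr0); split => //=; first exact: card_ord.
  by case=> f [_ /(_ _ _ xy)].
have [f0 f0E] := Vw _ V0; rewrite f0E in V0.
pose P f := `[< ex_values phi n F (w f) >].
have P0 : P f0 by apply/asboolP.
case: (arg_maxP w P0) => f /asboolP Vf fmax.
exists (w f); split => // z Vz; have [g gE] := Vw _ Vz.
by rewrite gE; apply/fmax/asboolP; rewrite -gE.
Qed.

(* Main.v *)
(* Set m = l - 1.  In a C_l-free digraph a set S of k vertices spans at most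
   C(k, 2) + sum_(j < k) (j mod m) arcs: for some s <= m there is a cycle C of
   length s in S but none of length s + 1, so that no vertex v of S outside C
   can be inserted into C; hence v and C are joined by at most s arcs, and one
   deletes C and inducts.  Adding the k (n - k) possible arcs leaving S, the k
   largest out-degrees sum to at most sum_(j < k) (n - 1 - m floor(j / m)),
   with equality for the transitive sequence of complete blocks of size m (the
   last one possibly smaller).  This weak majorization gives the inequality for
   the hinges x |-> max(x - t, 0), of which a nondecreasing convex function on
   integers is, up to a constant, a nonnegative combination. *)
Require Import Defs.
From mathcomp Require Import all_boot all_order all_algebra.
From mathcomp Require Import all_classical all_reals all_analysis.
From mathcomp Require Import zify lra.

Import Order.TTheory GRing.Theory Num.Theory.

(** * Sums of residues modulo [m] *)

Lemma bin2D a b : 'C(a + b, 2) = 'C(a, 2) + a * b + 'C(b, 2).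
Proof.
elim: b => [|b IH]; first by rewrite addn0 muln0 !addn0.
by rewrite addnS !binS !bin1 IH; lia.
Qed.

Lemma sum_modn m a b : b <= m ->
  \sum_(0 <= j < a * m + b) j %% m = a * 'C(m, 2) + 'C(b, 2).
Proof.
elim: a b => [|a IHa]; elim=> [|b IHb] bm.
- by rewrite big_geq.
- by rewrite addnS big_nat_recr //= IHb 1?ltnW // modnMDl modn_small // binS bin1 addnA.
- by rewrite mulSn addn0 addnC IHa // mulSn addn0 addnC.
- by rewrite addnS big_nat_recr //= IHb 1?ltnW // modnMDl modn_small // binS bin1 addnA.
Qed.

(** At most [m] consecutive integers have distinct residues, so their residues sum to at least 0 + 1
    + ... + (s - 1). This pays for the deletion of a cycle of length [s]. *)
Lemma sum_modn_addr m k s : s <= m ->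
  \sum_(0 <= j < k) j %% m + 'C(s, 2) <= \sum_(0 <= j < k + s) j %% m.
Proof.
case: m => [|m] sm; first by rewrite (_ : s = 0) ?addn0 //; lia.
rewrite (divn_eq k m.+1).
have : k %% m.+1 < m.+1 by rewrite ltn_mod.
move: (k %/ _) => a.
move: (k %% _) => b bm.
rewrite sum_modn; last exact: ltnW.
rewrite -(addnA (a * m.+1)).
have [h|h] := leqP (b + s) m.+1; first by rewrite sum_modn // bin2D; lia.
(* The new residues wrap around: [c] of them lie past the multiple of the modulus, and [u] residues
   of a full period are missed. In these terms the claim reduces to [c * u <= s * u]. *)
have [c [u [Eb Em]]] : exists c u, b = c + u /\ m.+1 = s + u.
  by exists (b + s - m.+1), (m.+1 - s); lia.
have -> : a * m.+1 + (b + s) = a.+1 * m.+1 + c by rewrite mulSn Em Eb; lia.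
rewrite sum_modn; last by lia.
rewrite mulSn [in leqRHS]Em Eb !bin2D Em bin2D.
have : c * u <= s * u by rewrite leq_mul2r; lia.
lia.
Qed.

(** * Arcs spanned by a vertex set without a cycle of a given length *)

Lemma cycle_insert (T : eqType) (e : rel T) p x v :
  uniq p -> cycle e p -> v \notin p -> x \in p -> e x v -> e v (next p x) ->
  exists p', [/\ uniq p', cycle e p', size p' = (size p).+1 & p' =i v :: p].
Proof.
move=> Up ep vp xp xv; have [i q E] := rot_to xp.
rewrite -(next_rot i Up) E => vn.
have mq : x :: q =i p by move=> z; rewrite -E mem_rot.
exists [:: x, v & q]; split.
- have : uniq (x :: q) by rewrite -E rot_uniq.
  have : v \notin x :: q by rewrite mq.
  by rewrite /= !inE negb_or eq_sym => /andP[/negPf -> ->].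
- have : cycle e (x :: q) by rewrite -E rot_cycle.
  rewrite /= xv; case: q {E mq} vn => [|y q] /=; rewrite eqxx => ->; first by [].
  by case/andP => _ ->.
- by rewrite /= -(size_rot i p) E.
- by move=> z; rewrite !inE -mq inE orbCA.
Qed.

Lemma sum_next (T : eqType) (F : T -> nat) p : uniq p ->
  \sum_(x <- p) F (next p x) = \sum_(x <- p) F x.
Proof.
move=> Up; rewrite -(big_map (next p) xpredT).
apply/perm_big/uniq_perm => //.
  by rewrite map_inj_uniq //; apply: can_inj (prev_next Up).
move=> x; apply/mapP/idP => [[y yp ->]|xp]; first by rewrite mem_next.
by exists (prev p x); rewrite ?mem_prev // next_prev.
Qed.

(** Pair the possible arc from [x] to [v] with the one from [v] to the successor of [x]: each of the
    [size p] pairs holds at most one arc, and reindexing by [next p] shows that every arc is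
    counted. *)
Lemma arcs_to_cycle (T : eqType) (e : rel T) p v :
  uniq p -> (forall x, x \in p -> ~~ (e x v && e v (next p x))) ->
  \sum_(x <- p) (e x v + e v x) <= size p.
Proof.
move=> Up H; rewrite big_split /= -(sum_next _ (fun x => e v x : nat)) //.
rewrite -big_split -sum1_size big_seq [leqRHS]big_seq leq_sum // => x /H.
by case: (e x v); case: (e v _).
Qed.

Lemma last_true (P : nat -> Prop) m : P 1 -> ~ P m.+1 ->
  exists s, [/\ 0 < s, s <= m, P s & ~ P s.+1].
Proof.
move=> P1; elim: m => // m IH Pm.
have [/IH [s [s0 sm Ps Ps1]]|/contrapT P'] := pselect (~ P m.+1).
  by exists s; split => //; apply: leqW.
by exists m.+1.
Qed.

(* A single vertex counts as a cycle of length 1, whence the reflexive closure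
   of e; this also makes the hypothesis with m = 1 say that e has no digon. *)
Lemma arcs_le (T : finType) (e : rel T) m (S : {set T}) :
  irreflexive e ->
  (forall p, uniq p -> cycle (fun x y => (x == y) || e x y) p ->
     size p != m.+1) ->
  \sum_(x in S) \sum_(y in S) e x y <=
    'C(#|S|, 2) + \sum_(0 <= j < #|S|) j %% m.
Proof.
move=> irr; set e' := fun x y => _ => nocyc.
have [k] := ubnP #|S|; elim: k S => // k IH S Sk.
have [->|[x0 x0S]] := set_0Vmem S; first by rewrite big_set0.
pose P s := exists p, [/\ uniq p, cycle e' p, size p = s & {subset p <= S}].
have [||s [s0 sm [p [Up ep ps pS]] Ps]] := last_true P m.
- exists [:: x0]; split => //; first by rewrite /= /e' eqxx.
  by move=> y; rewrite inE => /eqP ->.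
- by case=> p [Up ep ps _]; have := nocyc _ Up ep; rewrite ps eqxx.
pose C := [set x in p]; pose U := S :\: C.
have CS : C \subset S by apply/fintype.subsetP => x; rewrite inE => /pS.
have cC : #|C| = s by rewrite cardsE (card_uniqP Up).
have cS : #|S| = #|U| + s.
  by rewrite cardsD (finset.setIidPr CS) cC subnK // -cC subset_leq_card.
have splitS (F : T -> nat) :
    \sum_(x in S) F x = \sum_(x in C) F x + \sum_(x in U) F x.
  by rewrite (big_setID C) /= (finset.setIidPr CS).
rewrite splitS (eq_bigr _ (fun x _ => splitS _)) big_split /=.
rewrite [X in _ + X](eq_bigr _ (fun x _ => splitS _)) big_split /=.
have H1 : \sum_(x in C) \sum_(y in C) e x y <= s * s.-1.
  rewrite -[X in X * _]cC -sum_nat_const leq_sum // => x xC.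
  rewrite (big_setD1 x xC) /= irr add0n.
  apply: (@leq_trans (\sum_(y in C :\ x) 1)).
    by apply: leq_sum => y _; case: (e x y).
  by rewrite sum1_card; have := cardsD1 x C; rewrite xC cC => ->.
have H2 : \sum_(x in C) \sum_(y in U) e x y + \sum_(x in U) \sum_(y in C) e x y
    <= #|U| * s.
  rewrite exchange_big -big_split /= -sum_nat_const leq_sum // => v.
  rewrite !inE => /andP[vp vS].
  rewrite -big_split /= -big_filter.
  rewrite (perm_big p) /=; last first.
    by apply: uniq_perm => // [|x]; rewrite ?filter_uniq ?index_enum_uniq // mem_filter mem_index_enum inE andbT.
  rewrite -[leqRHS]ps; apply: arcs_to_cycle => // x xp; apply/negP => /andP[xv vn].
  apply: Ps; have [||p' [Up' ep' ps' mp]] := cycle_insert T e' p x v Up ep vp xp.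
  - by rewrite /e' xv orbT.
  - by rewrite /e' vn orbT.
  by exists p'; split; rewrite ?ps' ?ps // => y; rewrite mp inE => /predU1P[->|/pS].
have H3 : \sum_(x in U) \sum_(y in U) e x y <=
    'C(#|U|, 2) + \sum_(0 <= j < #|U|) j %% m by apply: IH; lia.
(* Of the bound 2 C(s, 2) for the arcs inside the cycle, one half completes C(|U|, 2) + |U| s to
   C(|S|, 2), and the other is absorbed by the residue sum. *)
have := sum_modn_addr m #|U| s sm; rewrite cS bin2D.
have : s * s.-1 = 2 * 'C(s, 2).
  by elim: (s) => // -[|t] // IHt; rewrite binS bin1 mulnDr -IHt /=; lia.
lia.
Qed.

(** * Weak majorization of the out-degrees *)

Lemma sum_outdeg_le (D : digraph) m (S : {set D}) :
  (forall p : seq D, uniq p -> cycle (fun x y => (x == y) || is_arc x y) p ->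
     size p != m.+1) ->
  \sum_(v in S) outdeg v <= \sum_(j < #|S|) (#|D|.-1 - (j - j %% m)).
Proof.
move=> /(arcs_le _ (@is_arc D) m S (@arc_irrefl D)) H.
have cS := cardsC S.
have degE (v : D) : outdeg v = \sum_(y in S) is_arc v y + \sum_(y in ~: S) is_arc v y.
  under [X in _ + X]eq_bigl do rewrite inE.
  rewrite /outdeg -sum1_card big_mkcond (bigID (mem S)) /=.
  by congr (_ + _); apply: eq_bigr => y _; rewrite inE; case: is_arc.
rewrite (eq_bigr _ (fun v _ => degE v)) big_split /=.
have H2 : \sum_(x in S) \sum_(y in ~: S) is_arc x y <= #|S| * #|~: S|.
  rewrite -sum_nat_const leq_sum // => x _; rewrite -sum1_card leq_sum // => y _.
  by case: is_arc.
apply: leq_trans (leq_add H H2) _; rewrite -cS.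
(* Only an inequality in the sizes of [S] and its complement is left: induct on the first with the
   second fixed. *)
elim: #|S| => [|k IH]; first by rewrite big_geq // big_ord0.
rewrite big_nat_recr //= binS bin1 mulSn big_ord_recr /=.
(* One more vertex raises each old term by exactly 1, since [i < k] keeps the subtractions from
   truncating. *)
have E : \sum_(i < k) ((k.+1 + #|~: S|).-1 - (i - i %% m)) =
  \sum_(i < k) ((k + #|~: S|).-1 - (i - i %% m)) + k.
  transitivity (\sum_(i < k) ((k + #|~: S|).-1 - (i - i %% m) + 1)); last first.
    by rewrite big_split /= sum1_card card_ord.
  by apply: eq_bigr => i _; have := ltn_ord i; have := leq_mod i m; lia.
rewrite E; move: IH (leq_mod k m).
move: (k %% m) (\sum_(0 <= i < k) _) (\sum_(i < k) _) => x y z; lia.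
Qed.

(** On the set [S] of vertices of out-degree above [t] the subtraction is exact, so the bound for
    [S] applies. On the right, truncation only enlarges the terms with [j < #|S|], and the other
    terms are nonnegative. *)
Lemma hinge_outdeg_le (D : digraph) m t :
  (forall p : seq D, uniq p -> cycle (fun x y => (x == y) || is_arc x y) p ->
     size p != m.+1) ->
  \sum_(v : D) (outdeg v - t) <=
    \sum_(j < #|D|) (#|D|.-1 - (j - j %% m) - t).
Proof.
move=> H; pose S := [set v : D | t < outdeg v].
rewrite (bigID (mem S)) /= [X in _ + X]big1 ?addn0; last first.
  by move=> v; rewrite inE -leqNgt => ?; apply/eqP; rewrite subn_eq0.
have E : \sum_(v in S) (outdeg v - t) + #|S| * t = \sum_(v in S) outdeg v.
  rewrite -sum_nat_const -big_split /=; apply: eq_bigr => v.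
  by rewrite inE => /ltnW /subnK.
have cS : #|S| <= #|D| by apply: max_card.
rewrite -(leq_add2r (#|S| * t)) E.
apply: leq_trans (sum_outdeg_le _ _ _ H) _.
rewrite (big_ord_widen _ (fun j => #|D|.-1 - (j - j %% m)) cS) big_mkcond /=.
have -> : #|S| * t = \sum_(j < #|D|) (if j < #|S| then t else 0).
  by rewrite -big_mkcond -(big_ord_widen _ (fun _ => t) cS) big_const_ord iter_addn_0 mulnC.
rewrite -big_split leq_sum // => j _.
by case: ifP => _ //=; rewrite addnC -leq_subLR.
Qed.

(** * Copies of the directed cycle as cyclic sequences *)

Lemma cycle_nthP (T : Type) (e : rel T) x0 (p : seq T) :
  reflect (forall i, i < size p -> e (nth x0 p i) (nth x0 p (i.+1 %% size p)))
    (cycle e p).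
Proof.
case: p => [|x p]; first by apply: ReflectT.
have nthE i : i < (size p).+1 ->
    nth x0 (rcons p x) i = nth x0 (x :: p) (i.+1 %% (size p).+1).
  rewrite ltnS leq_eqVlt nth_rcons => /predU1P[->|ip].
    by rewrite ltnn eqxx modnn.
  by rewrite ip modn_small.
have nthE' i : i < (size p).+1 -> nth x0 (x :: rcons p x) i = nth x0 (x :: p) i.
  by move=> ip; rewrite -rcons_cons nth_rcons ip.
rewrite /cycle; apply: (iffP (pathP x0)); rewrite size_rcons => H i ip.
  by have := H i ip; rewrite nthE // nthE'.
by have := H i ip; rewrite -nthE // -nthE'.
Qed.

Lemma contains_dicycleP l (hl : 1 < l) (D : digraph) :
  contains_copy (dicycle hl) D <->
  exists p : seq D, [/\ uniq p, cycle (@is_arc D) p & size p = l].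
Proof.
split=> [[f [finj farc]]|[p [Up cp sp]]].
  have l0 : 0 < l by apply: ltnW.
  pose o (i : nat) : 'I_l := Ordinal (ltn_pmod i l0).
  exists (mkseq (f \o o) l); split; last by rewrite size_mkseq.
    apply/mkseq_uniqP => i j; rewrite !inE => il jl /finj /(congr1 val) /=.
    by rewrite !modn_small.
  apply/(cycle_nthP _ _ (f (o 0))) => i; rewrite size_mkseq => il.
  rewrite !nth_mkseq ?ltn_mod ?l0 //; apply: farc.
  by apply/eqP/val_inj; rewrite /= (modn_small il) modn_mod.
case: p Up cp sp => [|x p] Up cp sp; first by move: (hl); rewrite -sp.
exists (fun i : 'I_l => nth x (x :: p) i); split=> [i j /eqP|i j /eqP ->].
  by rewrite nth_uniq ?sp // => /eqP/val_inj.
by have /(cycle_nthP _ _ x) /(_ i) := cp; rewrite sp; apply.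
Qed.

(** Successive entries of a duplicate-free cyclic sequence of length [l > 1] differ, so the
    reflexive alternative never occurs and every step is an arc. *)
Lemma free_dicycle_cycle l (hl : 1 < l) (D : digraph) (p : seq D) :
  free_of (dicycle hl) D -> uniq p ->
  cycle (fun x y => (x == y) || is_arc x y) p -> size p != l.
Proof.
move=> Dfree Up cp; apply/eqP => sp; apply: Dfree; apply/contains_dicycleP.
exists p; split=> //; case: p Up cp sp => // x p Up cp sp.
apply/(cycle_nthP _ _ x) => i ip; have /(cycle_nthP _ _ x) /(_ i ip) := cp.
case/orP => //; rewrite sp in ip *.
have ip' : i.+1 %% l < l by apply: ltn_pmod; apply: ltnW.
rewrite nth_uniq ?sp // => /eqP E; move: ip; rewrite leq_eqVlt => /predU1P[il|il].
  by move: E (hl); rewrite il modnn => i0; rewrite -il i0.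
by move: E; rewrite modn_small // => /eqP; rewrite ltn_eqF.
Qed.

(** * The extremal digraph: complete blocks in transitive order *)

Lemma block_arc_irrefl n m :
  irreflexive (fun i j : 'I_n => (i != j) && (i %/ m <= j %/ m)).
Proof. by move=> i; rewrite eqxx. Qed.

Definition block_digraph n m : digraph := Digraph (block_arc_irrefl n m).

(** The out-neighbours of [i] are all vertices from the start [i - i %% m] of its block onwards,
    except [i] itself. *)
Lemma outdeg_block n m (i : block_digraph n m) :
  0 < m -> outdeg i = n.-1 - (i - i %% m).
Proof.
move=> m0; have iE : i - i %% m = i %/ m * m by rewrite {1}(divn_eq i m) addnK.
have : #|[pred j : 'I_n | i %/ m <= j %/ m]| = n - i %/ m * m.
  rewrite -sum1_card (eq_bigl (fun j : 'I_n => i %/ m * m <= j)).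
    rewrite -(big_geq_mkord _ _ xpredT (fun _ => 1)).
    by rewrite sum_nat_const_nat muln1.
  by move=> j; rewrite inE leq_divRL.
rewrite (cardD1 i) inE leqnn iE add1n => /(congr1 predn) /= E.
rewrite -subn1 subnAC subn1 -E; apply: eq_card => j.
by rewrite !inE /= eq_sym.
Qed.

(** The block index cannot decrease along an arc, so it is constant on a cycle; within a block the
    residues modulo [m] are distinct, so a cycle has at most [m] vertices. *)
Lemma block_digraph_free n m l (hl : 1 < l) :
  0 < m -> m < l -> free_of (dicycle hl) (block_digraph n m).
Proof.
move=> m0 ml /contains_dicycleP[p [Up cp sp]].
have tr : transitive (fun x y : block_digraph n m => x %/ m <= y %/ m).
  by move=> y x z; apply: leq_trans.
have : cycle (fun x y : block_digraph n m => x %/ m <= y %/ m) p.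
  by apply: sub_cycle cp => x y /andP[].
rewrite cycle_all2rel // => /allrelP H.
have : size (map (fun x : block_digraph n m => x %% m) p) <= size (iota 0 m).
  apply: uniq_leq_size.
    rewrite map_inj_in_uniq // => x y xp yp E; apply: val_inj.
    rewrite /= (divn_eq x m) (divn_eq y m) E; congr (_ * _ + _).
    by apply/eqP; rewrite eqn_leq !H.
  by move=> _ /mapP[x _ ->]; rewrite mem_iota ltn_mod.
by rewrite size_map size_iota sp leqNgt ml.
Qed.

(** * Convex sequences as combinations of hinges *)

Local Open Scope ring_scope.

(** The second difference centred at [t], with [f] extended by f(-1) = f(0). Its value at 0 is thus
    the first increment, whose sign comes from monotonicity; the other signs come from convexity. *)
Definition second_diff (R : zmodType) (f : nat -> R) (t : nat) : R :=
  f t.+1 - f t - (if t is s.+1 then f t - f s else 0).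

Lemma sum_second_diff (R : zmodType) (f : nat -> R) k :
  \sum_(t < k.+1) second_diff R f t = f k.+1 - f k.
Proof.
elim: k => [|k IH]; first by rewrite big_ord1 /second_diff subr0.
by rewrite big_ord_recr IH /second_diff /= addrC subrK.
Qed.

(* Discrete Taylor formula: (x - t) is truncated subtraction. *)
Lemma hinge_expansion (R : zmodType) (f : nat -> R) N x : (x <= N)%N ->
  f x = f 0%N + \sum_(t < N) second_diff R f t *+ (x - t).
Proof.
move=> xN; have -> : \sum_(t < N) second_diff R f t *+ (x - t) =
    \sum_(t < x) second_diff R f t *+ (x - t).
  rewrite (big_ord_widen _ (fun t => second_diff R f t *+ (x - t)) xN).
  rewrite [RHS]big_mkcond; apply: eq_bigr => t _; case: ltnP => // xt.
  by rewrite (eqP (_ : x - t == 0)%N) // subn_eq0.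
elim: x {N xN} => [|x IH]; first by rewrite big_ord0 addr0.
rewrite (eq_bigr (fun t : 'I_x.+1 =>
    second_diff R f t *+ (x - t) + second_diff R f t)).
  rewrite big_split sum_second_diff big_ord_recr /= subnn addr0 addrA -IH.
  by rewrite addrC subrK.
by move=> t _; rewrite subSn ?mulrSr // -ltnS.
Qed.

(** Expand both sides in hinges: the constants [f 0] cancel because [I] and [J] have equal size, and
    every coefficient [second_diff] is nonnegative. *)
Lemma sum_le_of_hinges (R : numDomainType) (I J : finType) N (f : nat -> R)
    (a : I -> nat) (b : J -> nat) :
  #|I| = #|J| ->
  (forall i, a i <= N)%N -> (forall j, b j <= N)%N ->
  ((0 < N)%N -> f 0%N <= f 1%N) ->
  (forall t, (t.+1 < N)%N -> f t.+1 - f t <= f t.+2 - f t.+1) ->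
  (forall t, \sum_i (a i - t) <= \sum_j (b j - t))%N ->
  \sum_i f (a i) <= \sum_j f (b j).
Proof.
move=> IJ aN bN f01 fconv ab.
rewrite (eq_bigr _ (fun i _ => hinge_expansion _ f _ _ (aN i))).
rewrite [leRHS](eq_bigr _ (fun j _ => hinge_expansion _ f _ _ (bN j))).
rewrite !big_split /= !sumr_const IJ lerD2l exchange_big [leRHS]exchange_big /=.
apply: ler_sum => t _; rewrite !sumrMnr; apply: ler_wpMn2l => //.
rewrite subr_ge0; case: t => -[|t] tN /=; last exact: fconv.
by rewrite subr_ge0 f01.
Qed.

(** * Evaluation of the bound and conclusion *)

(** The argument of [F] is constant on each run of [m] indices. Allowing [r = m] lets the induction
    pass from a full last run to the next [q]. *)
Lemma sum_blocks (R : pzRingType) (F : nat -> R) m q r : (r <= m)%N ->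
  \sum_(0 <= j < q * m + r) F (j - j %% m)%N =
    \sum_(0 <= i < q) m%:R * F (i * m)%N + r%:R * F (q * m)%N.
Proof.
have step k s : (s < m)%N ->
    \sum_(0 <= j < k * m + s.+1) F (j - j %% m)%N =
    \sum_(0 <= j < k * m + s) F (j - j %% m)%N + F (k * m)%N.
  by move=> sm; rewrite addnS big_nat_recr //= modnMDl modn_small // addnK.
elim: q r => [|q IHq]; elim=> [|r IHr] rm.
- by rewrite !big_geq // mul0r addr0.
- by rewrite step // IHr 1?ltnW // -addrA -[in RHS]natr1 mulrDl mul1r.
- by rewrite mulSn addn0 addnC IHq // big_nat_recr //= mul0r addr0.
- by rewrite step // IHr 1?ltnW // -addrA -[in RHS]natr1 mulrDl mul1r.
Qed.

Lemma convex_function_midpoint (R : realType) (A : set R) (f : R -> R) (x y : R) :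
  convex_function A f -> A x -> A y -> f ((x + y) / 2) <= (f x + f y) / 2.
Proof.
move=> fA Ax Ay; have h0 : 0 <= 2^-1 :> R by lra.
have h1 : 2^-1 <= 1 :> R by lra.
have := fA (Itv01 h0 h1) x y (mem_set Ax) (mem_set Ay).
have -> : conv (Itv01 h0 h1) (x : convex_lmodType R^o) y = (x + y) / 2.
  by rewrite [LHS](_ : _ = 2^-1 * x + (1 - 2^-1) * y) //; lra.
rewrite convRE /= /unstable.onem; lra.
Qed.

Local Open Scope classical_set_scope.
Local Open Scope ring_scope.

Lemma sum_phi_outdeg_le (R : realType) (phi : R -> R) (n m l : nat)
    (hl : (1 < l)%N) (D : digraph) :
  (0 < n)%N -> l = m.+1 -> #|D| = n -> free_of (dicycle hl) D ->
  {in `[0, n%:R - 1] &, nondecreasing_fun phi} ->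
  convex_function (`[0, n%:R - 1]%classic : set R) phi ->
  \sum_(v : D) phi (outdeg v)%:R <=
    \sum_(j < n) phi (n.-1 - (j - j %% m))%:R.
Proof.
move=> n0 lm cD Dfree phi_nd phi_cv.
have memI k : (k <= n.-1)%N -> (k%:R : R) \in `[0, n%:R - 1].
  by move=> kn; rewrite in_itv /= ler0n -(prednK n0) -natr1 addrK ler_nat.
apply: (@sum_le_of_hinges R D 'I_n n.-1 (fun k => phi k%:R) (@outdeg D)
  (fun j => n.-1 - (j - j %% m))%N).
- by rewrite card_ord.
- move=> v; rewrite -cD (cardD1 v) add1n /=; apply: subset_leq_card.
  apply/fintype.subsetP => w; rewrite !inE => vw; rewrite andbT.
  by apply: contraTneq vw => ->; rewrite arc_irrefl.
- by move=> j; apply: leq_subr.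
- by move=> N0; apply: phi_nd; rewrite ?memI ?ler_nat.
(* Convexity of the sequence at [t.+1] is midpoint convexity between [t] and [t.+2]. *)
- move=> t tN; have := @convex_function_midpoint R _ phi t%:R t.+2%:R phi_cv.
  have -> : (t%:R + t.+2%:R) / 2 = t.+1%:R :> R by rewrite -[t.+2%:R]natr1 -[t.+1%:R]natr1; lra.
  move=> H; have : phi t.+1%:R <= (phi t%:R + phi t.+2%:R) / 2.
    by apply: H; apply: memI; lia.
  by lra.
- move=> t; rewrite -cD; apply: hinge_outdeg_le => p Up cp; rewrite -lm.
  exact: free_dicycle_cycle Dfree Up cp.
Qed.

Theorem theorem1p2 (R : realType) (l n q r : nat) (phi : R -> R)
    (hl : (3 <= l)%N) (hn : (1 <= n)%N)
    (hnqr : n = ((l - 1) * q + r)%N) (hr : (r < l - 1)%N)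
    (phi_nondecreasing : {in `[0, n%:R - 1] &, nondecreasing_fun phi})
    (phi_convex : convex_function (`[0, n%:R - 1]%classic : set R) phi) :
  ex_plus phi n (dicycle (ltnW hl)) =
    \sum_(1 <= i < q.+1)
       (l - 1)%:R * phi ((l - 1) * (q - i + 1) - 1 + r)%:R
    + (if (0 < r)%N then r%:R * phi (r - 1)%:R else 0).
Proof.
have lm : l = (l - 1).+1 by rewrite subn1 prednK //; apply: leq_trans hl.
have m0 : (0 < l - 1)%N by lia.
set m := (l - 1)%N in hnqr hr lm m0 *.
(* The closed form is the value of the block digraph, summed block by block; its index [i] starts at
   1, while blocks are counted from 0. *)
have <- : \sum_(j < n) phi (n.-1 - (j - j %% m))%:R =
    \sum_(1 <= i < q.+1) m%:R * phi (m * (q - i + 1) - 1 + r)%:R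
    + (if (0 < r)%N then r%:R * phi (r - 1)%:R else 0).
  rewrite -(big_mkord xpredT (fun j => phi (n.-1 - (j - j %% m))%:R)).
  rewrite [in X in \sum_(0 <= j < X) _]hnqr mulnC.
  rewrite (@sum_blocks R (fun k => phi (n.-1 - k)%:R)); last exact: ltnW.
  rewrite big_add1 /=.
  congr (_ + _); last first.
    case: r hnqr hr => [|r] hnqr hr /=; first by rewrite mul0r.
    by congr (_ * phi _%:R); lia.
  apply: eq_big_nat => i /andP[_ iq]; congr (_ * phi _%:R).
  have -> : (q - i.+1 + 1 = q - i)%N by lia.
  (* Positivity makes the subtraction of 1 before adding [r] exact. *)
  have : (0 < m * (q - i))%N by rewrite muln_gt0 m0 subn_gt0.
  by rewrite hnqr -[X in (m * X + r)%N](subnKC (ltnW iq)) mulnDr; lia.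
have [] : is_max (ex_values phi n (dicycle (ltnW hl)))
    (ex_plus phi n (dicycle (ltnW hl))).
  have l0 : (0 < l)%N by lia.
  (* The arc from 0 to its successor ensures that the maximum exists. *)
  exact: (@ex_plusP R phi n _ (Ordinal l0 : dicycle (ltnW hl)) _ (eqxx _)).
case=> D [cD Dfree ->] ub; apply/eqP; rewrite eq_le; apply/andP; split.
  exact: sum_phi_outdeg_le lm cD Dfree _ _.
apply: ub; exists (block_digraph n m); split.
- exact: card_ord.
- by apply: block_digraph_free; lia.
- by apply: eq_bigr => i _; rewrite outdeg_block.
Qed.
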